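(* Let $T$ be the set of triples $(a,b,c)$ of integers with $1\le a<b<c$ such that $(a,b,c)$ is a pseudoperiod of the Thue–Morse sequence $\mathbf{t}$, i.e., $\mathbf{t}[i]\in\{\mathbf{t}[i+a],\mathbf{t}[i+b],\mathbf{t}[i+c]\}$ for all $i\ge0$. There is a deterministic finite automaton with $53$ states that, reading the base-$2$ representations of $a,b,c$ in parallel (most significant digit first, padded with leading zeros to a common length), accepts exactly the triples in $T$.
   Context: The Thue–Morse sequence $\mathbf{t}=01101001\cdots$ is the infinite fixed point, starting with $0$, of the morphism $0\mapsto01$, $1\mapsto10$; it is indexed from $0$. *)

(* Defs.v *)
From mathcomp Require Import all_boot.

Set Implicit Arguments.
Unset Strict Implicit.
Unset Printing Implicit Defensive.

(* The letters 0 and 1 are [false] and [true]. *)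
Definition tm_morphism (b : bool) : seq bool :=
  if b then [:: true; false] else [:: false; true].

Definition apply_morphism (h : bool -> seq bool) (w : seq bool) : seq bool :=
  flatten (map h w).

(* The iterates of the morphism on 0 are prefixes of one another, and the n-th
   has length 2 ^ n > n, so the default value of [nth] is never reached. *)
Definition thue_morse (n : nat) : bool :=
  nth false (iter n (apply_morphism tm_morphism) [:: false]) n.

Definition pseudoperiod3 (s : nat -> bool) (a b c : nat) : Prop :=
  forall i : nat, s i \in [:: s (i + a); s (i + b); s (i + c)].

Definition in_T (a b c : nat) : Prop :=
  [/\ 1 <= a, a < b, b < c & pseudoperiod3 thue_morse a b c].

(* Deterministic automata with a partial transition function: a missing
   transition rejects, so a dead state is neither needed nor counted. *)
Record dfa (char : Type) := Dfa {
  dfa_state : finType;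
  dfa_init : dfa_state;
  dfa_final : {set dfa_state};
  dfa_trans : dfa_state -> char -> option dfa_state
}.

Definition dfa_run (char : Type) (A : dfa char) (w : seq char) :
    option (dfa_state A) :=
  foldl (fun oq x => obind (fun q => dfa_trans q x) oq) (Some (dfa_init A)) w.

Definition dfa_accepts (char : Type) (A : dfa char) (w : seq char) : bool :=
  if dfa_run A w is Some q then q \in dfa_final A else false.

(* Value of a base-2 digit string, most significant digit first; the strings of
   value n are the base-2 representation of n preceded by any number of 0s. *)
Definition base2_value (s : seq bool) : nat :=
  foldl (fun v (d : bool) => 2 * v + d) 0 s.

Definition represents (w : seq (bool * bool * bool)) (a b c : nat) : Prop :=
  [/\ base2_value [seq x.1.1 | x <- w] = a,
      base2_value [seq x.1.2 | x <- w] = b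
    & base2_value [seq x.2 | x <- w] = c].

Lemma apply_morphism_cat h u v :
  apply_morphism h (u ++ v) = apply_morphism h u ++ apply_morphism h v.
Proof. by rewrite /apply_morphism map_cat flatten_cat. Qed.

Lemma size_tm_morphism w :
  size (apply_morphism tm_morphism w) = (size w).*2.
Proof. by elim: w => [|[] w IH] //=; rewrite -/(apply_morphism _ w) IH. Qed.

Lemma size_tm_iter n :
  size (iter n (apply_morphism tm_morphism) [:: false]) = 2 ^ n.
Proof. by elim: n => [|n IH] //=; rewrite size_tm_morphism IH expnS mul2n. Qed.

Lemma nth_tm_morphism w k (b : bool) : k < size w ->
  nth false (apply_morphism tm_morphism w) (b + k.*2) = b (+) nth false w k.
Proof.
elim: w k b => [|x w IH] [|k] b //= lt_k.
- by case: b; case: x.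
- by rewrite -IH // doubleS !addnS; case: x.
Qed.

Lemma tm_iter_prefix m n : m <= n ->
  prefix (iter m (apply_morphism tm_morphism) [:: false])
         (iter n (apply_morphism tm_morphism) [:: false]).
Proof.
elim: n => [|n IH]; first by rewrite leqn0 => /eqP ->; exact: prefix_refl.
rewrite leq_eqVlt => /predU1P[->|/IH le_mn]; first exact: prefix_refl.
apply: prefix_trans le_mn _.
elim: n {IH} => [|n /prefixP[v Ev]] //=.
by rewrite {2}[apply_morphism _ _]Ev apply_morphism_cat prefix_prefix.
Qed.

Lemma thue_morse_iter m n : n < 2 ^ m ->
  thue_morse n = nth false (iter m (apply_morphism tm_morphism) [:: false]) n.
Proof.
move=> lt_n; have lt_nn : n < 2 ^ n by exact: ltn_expl.
rewrite /thue_morse; have [le|/ltnW le] := leqP n m.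
- have /prefixP[v ->] := tm_iter_prefix le.
  by rewrite nth_cat size_tm_iter lt_nn.
- have /prefixP[v ->] := tm_iter_prefix le.
  by rewrite nth_cat size_tm_iter lt_n.
Qed.

(* [thue_morse] is a fixed point of the morphism. *)
Lemma thue_morse_fixed n :
  [:: thue_morse n.*2; thue_morse n.*2.+1] = tm_morphism (thue_morse n).
Proof.
have lt_n : n < 2 ^ n by exact: ltn_expl.
have lt1 : n.*2.+1 < 2 ^ n.+1 by rewrite expnS mul2n -doubleS ltn_Sdouble.
have lt0 : n.*2 < 2 ^ n.+1 by apply: ltn_trans lt1.
rewrite (thue_morse_iter lt0) (thue_morse_iter lt1) (thue_morse_iter lt_n) /=.
have lts : n < size (iter n (apply_morphism tm_morphism) [:: false]).
  by rewrite size_tm_iter.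
have := nth_tm_morphism false lts; rewrite add0n => ->.
have := nth_tm_morphism true lts; rewrite add1n => ->.
by case: (nth _ _ _).
Qed.

(* Main.v *)
(** For i, a, b, c consider the six bits t[i] + t[i+a], t[i] + t[i+a+1] (mod 2),
    and the same for b and c.  Because t[2n] = t[n] and t[2n+1] = 1 - t[n], the
    bits of (2i+e, 2a+x, 2b+y, 2c+z) are a function of (e, x, y, z) and of the
    bits of (i, a, b, c).  Hence the set S(a,b,c) of all vectors of six bits that
    occur for some i is computed from the digits of a, b, c by a finite automaton,
    and (a,b,c) is a pseudoperiod iff no vector of S(a,b,c) has its first, third
    and fifth bits equal to 1.

    The 53-state automaton is the minimal quotient of that one.  It is justified by
    bounds on S(a,b,c) that are propagated along the transitions: one upper bound
    per state, a list of alternative lower bounds per state, and, for the missing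
    transitions, a family of sets which S(a,b,c) meets from then on. *)

From Stdlib Require Import NArith.
Require Import Defs.
From mathcomp Require Import all_boot zify.

Set Implicit Arguments.
Unset Strict Implicit.
Unset Printing Implicit Defensive.

(** * Difference vectors *)

Definition letter : Type := bool * bool * bool.
Definition vec : Type := (bool * bool) * (bool * bool) * (bool * bool).

Lemma thue_morse_double n : thue_morse n.*2 = thue_morse n.
Proof. by have := thue_morse_fixed n; case: (thue_morse n) => -[]. Qed.

Lemma thue_morse_doubleS n : thue_morse n.*2.+1 = ~~ thue_morse n.
Proof. by have := thue_morse_fixed n; case: (thue_morse n) => -[]. Qed.

Definition diffs (i a : nat) : bool * bool :=
  (thue_morse i (+) thue_morse (i + a), thue_morse i (+) thue_morse (i + a).+1).

Definition diff_vec (i a b c : nat) : vec := (diffs i a, diffs i b, diffs i c).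

(** [digit k] is t[2i+e] + t[2(i+a)+k] (mod 2). Since [k] is at most 3, its half selects t[i+a] or
    t[i+a+1], and the parities of [k] and [e] flip the bit. *)
Definition next_diffs (e x : bool) (p : bool * bool) : bool * bool :=
  let digit k := (if k <= 1 then p.1 else p.2) (+) odd k (+) e in
  (digit (e + x), digit (e + x).+1).

Lemma diffs_step (e x : bool) i a :
  diffs (2 * i + e) (2 * a + x) = next_diffs e x (diffs i a).
Proof.
rewrite /diffs /next_diffs.
have -> : 2 * i + e + (2 * a + x) = (i + a).*2 + (e + x) by lia.
have -> : 2 * i + e = i.*2 + e by lia.
case: e; case: x; rewrite /= ?addn0 ?addn1 ?addn2 -?doubleS;
  rewrite ?thue_morse_double ?thue_morse_doubleS;
  by congr (_, _); do 3?case: (thue_morse _).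
Qed.

Definition next (l : letter) (e : bool) (v : vec) : vec :=
  (next_diffs e l.1.1 v.1.1, next_diffs e l.1.2 v.1.2, next_diffs e l.2 v.2).

Definition occurs (a b c : nat) (v : vec) : Prop := exists i, diff_vec i a b c = v.

Lemma occurs_next a b c (l : letter) e v : occurs a b c v ->
  occurs (2 * a + l.1.1) (2 * b + l.1.2) (2 * c + l.2) (next l e v).
Proof. by case=> i <-; exists (2 * i + e); rewrite /diff_vec !diffs_step. Qed.

(** Every index has the form 2i+e, so together with [occurs_next] the set S of the extended triple
    is exactly the image of S(a,b,c). *)
Lemma occurs_nextP a b c (l : letter) v :
  occurs (2 * a + l.1.1) (2 * b + l.1.2) (2 * c + l.2) v ->
  exists2 u, occurs a b c u & exists e, v = next l e u.
Proof.
case=> i <-; exists (diff_vec i./2 a b c); first by exists i./2.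
exists (odd i); rewrite /next /diff_vec /= -!diffs_step.
by have -> : 2 * i./2 + odd i = i by lia.
Qed.

Definition all_differ (v : vec) : bool := [&& v.1.1.1, v.1.2.1 & v.2.1].

Lemma pseudoperiod3P a b c :
  pseudoperiod3 thue_morse a b c <->
  forall v, occurs a b c v -> ~~ all_differ v.
Proof.
have E i : (thue_morse i \in
    [:: thue_morse (i + a); thue_morse (i + b); thue_morse (i + c)])
    = ~~ all_differ (diff_vec i a b c).
  rewrite !inE /all_differ /=.
  by do 4 case: (thue_morse _).
split=> [per v [i <-]|non i]; first by rewrite -E.
by rewrite E; apply: non; exists i.
Qed.

(** * Sets of vectors as bit masks *)

Definition bool_pairs : seq (bool * bool) :=
  [seq (p, q) | p <- [:: false; true], q <- [:: false; true]].

Definition vecs : seq vec :=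
  [seq (p, q) | p <- [seq (p, q) | p <- bool_pairs, q <- bool_pairs],
                q <- bool_pairs].

Lemma mem_vecs v : v \in vecs.
Proof. by case: v => [[[[] []] [[] []]] [[] []]]. Qed.

(** The six bits form a number below 64, so a set of vectors fits in a 64-bit mask and set
    operations become bitwise ones. *)
Definition code (v : vec) : N :=
  foldl (fun n (d : bool) => if d then N.succ_double n else N.double n) 0%num
    [:: v.1.1.1; v.1.1.2; v.1.2.1; v.1.2.2; v.2.1; v.2.2].

Definition decode (n : N) : vec :=
  let bit k := N.testbit n k in
  ((bit 5, bit 4), (bit 3, bit 2), (bit 1, bit 0))%num.

Lemma codeK : cancel code decode.
Proof. by case=> [[[[] []] [[] []]] [[] []]]. Qed.

Definition mem_mask (m : N) (v : vec) : bool := N.testbit m (code v).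

Definition mask_of (s : seq vec) : N :=
  foldr (fun v m => N.setbit m (code v)) 0%num s.

Lemma mem_mask_of s v : mem_mask (mask_of s) v = (v \in s).
Proof.
rewrite /mem_mask; elim: s => [|u s IH] /=; first by case: (code v).
rewrite N.setbit_eqb IH inE; congr (_ || _).
by apply/N.eqb_spec/eqP => [/(can_inj codeK)|->].
Qed.

Definition sub_mask (m n : N) : bool := N.eqb (N.ldiff m n) 0.

Lemma sub_maskP m n v : sub_mask m n -> mem_mask m v -> mem_mask n v.
Proof.
rewrite /sub_mask /mem_mask => /N.eqb_spec mn0 mv; apply/negPn/negP => nv.
by have := N.ldiff_spec m n (code v); rewrite mn0 mv nv; case: (code v).
Qed.

(* Only soundness matters: if the masks are disjoint, the candidate common
   element given by the junk value [N.log2 0] is rejected by the test. *)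
Definition meets (m n : N) : bool :=
  let v := decode (N.log2 (N.land m n)) in
  if mem_mask m v then mem_mask n v else false.

Lemma meetsP m n : meets m n -> exists2 v, mem_mask m v & mem_mask n v.
Proof. by rewrite /meets; case: ifP => // mv nv; eexists; eauto. Qed.

Definition image_mask (l : letter) (m : N) : N :=
  mask_of (flatten [seq [:: next l false v; next l true v]
                   | v <- [seq v <- vecs | mem_mask m v]]).

Lemma mem_image_mask l m v :
  reflect (exists2 u, mem_mask m u & exists e, v = next l e u)
          (mem_mask (image_mask l m) v).
Proof.
rewrite mem_mask_of; apply: (iffP flatten_mapP) => [[u]|[u mu [e ->]]].
  rewrite mem_filter !inE => /andP[mu _] /orP[] /eqP ->;
  by exists u => //; eexists.
exists u; first by rewrite mem_filter mu mem_vecs.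
by rewrite !inE; case: e; rewrite eqxx ?orbT.
Qed.

(** One successor in [m] suffices: if S(a,b,c) meets this set, then S of the extended triple meets
    [m]. *)
Definition preimage_mask (l : letter) (m : N) : N :=
  mask_of [seq v <- vecs | mem_mask m (next l false v) || mem_mask m (next l true v)].

Lemma mem_preimage_mask l m v :
  mem_mask (preimage_mask l m) v ->
  exists e, mem_mask m (next l e v).
Proof.
by rewrite mem_mask_of mem_filter mem_vecs andbT => /orP[]; eexists; eassumption.
Qed.

(** * The automaton *)

(* Row q lists the successors of state q under the letters 000, 001, ..., 111;
   the number 53 stands for a missing transition. *)
Definition tm_table : seq (seq nat) := [::
   [:: 0; 1; 53; 2; 53; 53; 53; 3]; [:: 53; 53; 4; 5; 53; 53; 6; 7];
   [:: 8; 9; 53; 53; 10; 11; 53; 12]; [:: 3; 13; 53; 14; 53; 53; 53; 3];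
   [:: 15; 53; 16; 53; 17; 53; 18; 19]; [:: 53; 53; 53; 53; 53; 53; 20; 53];
   [:: 21; 53; 22; 23; 53; 53; 13; 53]; [:: 53; 53; 53; 24; 53; 53; 53; 25];
   [:: 26; 53; 53; 53; 27; 53; 53; 53]; [:: 53; 53; 53; 53; 53; 53; 23; 53];
   [:: 28; 29; 53; 53; 14; 19; 53; 53]; [:: 30; 53; 53; 53; 53; 31; 24; 19];
   [:: 53; 24; 53; 53; 53; 32; 53; 33]; [:: 53; 53; 19; 53; 53; 53; 13; 53];
   [:: 53; 53; 53; 53; 14; 19; 53; 53]; [:: 15; 53; 53; 53; 53; 53; 53; 19];
   [:: 53; 53; 34; 5; 53; 53; 53; 53]; [:: 53; 53; 53; 53; 35; 53; 53; 53];
   [:: 53; 53; 53; 53; 53; 53; 18; 24]; [:: 19; 53; 53; 53; 53; 53; 53; 19];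
   [:: 53; 53; 53; 53; 53; 53; 36; 53]; [:: 37; 53; 38; 53; 53; 53; 53; 53];
   [:: 39; 53; 40; 53; 53; 24; 53; 19]; [:: 53; 53; 53; 53; 24; 53; 53; 53];
   [:: 24; 53; 53; 53; 53; 53; 53; 53]; [:: 53; 53; 24; 24; 53; 53; 53; 7];
   [:: 41; 9; 53; 53; 53; 42; 53; 53]; [:: 53; 53; 53; 53; 53; 43; 53; 53];
   [:: 44; 29; 53; 53; 53; 45; 53; 53]; [:: 53; 53; 53; 53; 53; 53; 24; 53];
   [:: 46; 53; 53; 53; 53; 53; 53; 19]; [:: 53; 53; 53; 53; 53; 47; 53; 53];
   [:: 24; 53; 53; 53; 53; 48; 53; 53]; [:: 53; 24; 53; 53; 53; 24; 53; 33];
   [:: 53; 53; 16; 53; 53; 53; 49; 53]; [:: 53; 53; 53; 53; 17; 53; 53; 24];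
   [:: 24; 53; 53; 53; 53; 53; 20; 53]; [:: 21; 53; 38; 23; 53; 53; 53; 53];
   [:: 53; 53; 53; 53; 53; 24; 53; 53]; [:: 50; 53; 53; 53; 53; 53; 53; 19];
   [:: 53; 53; 51; 53; 53; 53; 53; 53]; [:: 26; 53; 53; 53; 53; 53; 53; 53];
   [:: 52; 53; 53; 53; 53; 53; 24; 53]; [:: 53; 53; 53; 24; 53; 53; 53; 53];
   [:: 28; 29; 53; 53; 53; 53; 53; 53]; [:: 53; 53; 24; 53; 53; 53; 53; 53];
   [:: 30; 53; 53; 53; 53; 53; 24; 19]; [:: 53; 53; 53; 53; 53; 31; 53; 24];
   [:: 53; 53; 53; 53; 53; 32; 53; 53]; [:: 53; 53; 53; 53; 53; 53; 53; 24];
   [:: 39; 53; 53; 53; 53; 24; 53; 19]; [:: 53; 53; 40; 53; 53; 53; 53; 24];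
   [:: 42; 53; 53; 53; 53; 53; 53; 53]].

Definition tm_finals : seq nat :=
  [:: 11; 19; 22; 24; 30; 32; 36; 39; 42; 46; 50; 52].

Definition letter_index (l : letter) : nat := 4 * l.1.1 + 2 * l.1.2 + l.2.

Definition tm_delta (q : nat) (l : letter) : nat :=
  nth 53 (nth [::] tm_table q) (letter_index l).

Definition tm_dfa : dfa letter :=
  @Dfa letter 'I_53 ord0 [set q : 'I_53 | val q \in tm_finals]
    (fun q l => insub (tm_delta q l)).

(** A dead run gets the number 53, which has no row in [tm_table]; the default values of [nth] make
    it absorbing. *)
Definition state_index (oq : option 'I_53) : nat :=
  if oq is Some q then val q else 53.

Lemma tm_delta_leq q l : tm_delta q l <= 53.
Proof.
have /allP rows : all (all (leq^~ 53)) tm_table by [].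
rewrite /tm_delta; have [lt_q|ge_q] := ltnP q (size tm_table); last first.
  by rewrite (nth_default [::] ge_q) nth_nil.
have /allP row := rows _ (mem_nth [::] lt_q).
set r := nth _ _ q in row *.
have [lt_l|ge_l] := ltnP (letter_index l) (size r); last by rewrite nth_default.
exact/row/mem_nth.
Qed.

Lemma state_index_trans (oq : option 'I_53) l :
  state_index (obind (fun q => @dfa_trans _ tm_dfa q l) oq)
  = tm_delta (state_index oq) l.
Proof.
case: oq => [q|] /=; last first.
  by rewrite /tm_delta (nth_default [::]) // nth_nil.
case: insubP => [u _ <-|] //=.
(* [insub] fails only from 53 on, and no successor exceeds 53. *)
by rewrite -leqNgt => le53; apply/eqP; rewrite eqn_leq le53 tm_delta_leq.
Qed.

(** * Bounds on the set of occurring vectors *)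

(* Bit [code v] of a mask tells whether [v] belongs to the set. *)
Definition tm_upper : seq N := [::
   0x200001; 0xc00002; 0x84000020; 0x8000040000200001; 0x430000c0; 0x3e3c0260;
   0x4000030000c00000; 0xb0000a0000600008; 0x4218400; 0x3c24202;
   0x400002184000000; 0x300008242000000; 0x21802004200000; 0x4000030000c00002;
   0x400002184000020; 0x474cb8c8; 0x42c20380; 0x600004cbe000040;
   0x404240c043c04040; 0x131d32e2474cb8c8; 0x242663f20f306002;
   0xb0000e000040000c; 0x30000c2400000c0; 0x460203ff33c00060;
   0x33ff33ffffffffff; 0x9000020000e0000a; 0x84208021; 0x420840080210000;
   0x8021842004008400; 0x424243c243004200; 0x101d326006009800;
   0x90000226e0000a0; 0x190222244e60a80; 0x8021802084208020; 0x434201c0;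
   0x60000c8d7000040; 0x200603f02f346262; 0xd000070000c00008;
   0xf0000f64c0000c0; 0x101d3260044c8808; 0x1c0434240c00080; 0x4218401;
   0x138902e246229001; 0x2c0420043c20300; 0x8401042184008000;
   0x100430242c20380; 0x130902e246009000; 0xb0000a266000080;
   0x1b02a2244660880; 0x424242c203800000; 0x130902e2444080c8;
   0x38042c2404000c0; 0x101d326406209811]%num.

(* An entry (q, f, ms): whenever (a, b, c) leads to q and f records which of
   0 < a, a < b, b < c hold, some mask of ms is included in S(a,b,c). *)
Definition tm_lower : seq (nat * (bool * bool * bool) * seq N) := [::
   (0%N, (false, false, false), [:: 0x200001]);
   (1%N, (false, false, true), [:: 0xc00002]);
   (2%N, (false, true, false), [:: 0x84000020]);
   (3%N, (true, false, false), [:: 0x40000200000]);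
   (4%N, (false, true, true), [:: 0x430000c0]);
   (5%N, (false, true, true), [:: 0x3a000060; 0x16200040]);
   (6%N, (true, false, true), [:: 0x4000030000c00000]);
   (7%N, (true, false, true), [::
     0x30000a0000600000; 0x90000a0000600000]);
   (8%N, (false, true, false), [:: 0x4218400]);
   (9%N, (false, true, true), [:: 0x1824200]);
   (10%N, (true, true, false), [:: 0x400002184000000]);
   (11%N, (true, true, true), [:: 0x300008242000000]);
   (12%N, (true, true, false), [:: 0x1802004200000]);
   (13%N, (true, false, true), [:: 0x4000010000800002]);
   (14%N, (true, true, false), [:: 0x400000180000020]);
   (15%N, (false, true, true), [:: 0x6401800; 0x6409008]);
   (16%N, (false, true, true), [:: 0x40420380]);
   (17%N, (true, true, true), [:: 0x400004c18000000]);
   (18%N, (true, true, true), [:: 0x42408001800000; 0x4002004001804000]);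
   (19%N, (true, true, true), [::
     0x14100006400000; 0x100004243000040; 0x8022006400000; 0x200008241000040;
     0x1001004006400000; 0x26006000008; 0x26006400000]);
   (20%N, (true, true, true), [:: 0x24400001100000; 0x2004400001100000]);
   (21%N, (true, false, true), [:: 0x60000000004]);
   (22%N, (true, true, true), [:: 0x300004240000080]);
   (23%N, (true, true, true), [::
     0x600000010000060; 0x4000014201400000]);
   (24%N, (true, true, true), [::
     0x200006090000060; 0x42010001804000; 0x2028001804002; 0x2004000006600000;
     0x100002424000080; 0x200000990000000; 0x26006600000; 0x100006060000090;
     0x40201024000060; 0x2028002804002; 0x2000006006000004; 0x80020242420000;
     0x18006200008; 0x80202004040100; 0x60020002000400; 0x42010041800000;
     0x40202028040020; 0x80202006060000; 0x16006800000; 0x2004020014600000;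
     0x206002200808; 0x1000000982000000; 0x2028042800002]);
   (25%N, (true, false, true), [:: 0x900002000060000a]);
   (26%N, (false, true, false), [:: 0x84208021]);
   (27%N, (true, true, false), [:: 0x420840000200000]);
   (28%N, (true, true, false), [:: 0x20042004000000]);
   (29%N, (true, true, true), [::
     0x40414001004000; 0x4000018001004000; 0x4040010001004000]);
   (30%N, (true, true, true), [:: 0x4320006000800; 0x1004204006000800]);
   (31%N, (true, true, true), [:: 0x9000020240000a0]);
   (32%N, (true, true, true), [:: 0x80020240420200; 0x80200240020280]);
   (33%N, (true, true, false), [:: 0x8001002004208000]);
   (34%N, (false, true, true), [:: 0x41020180]);
   (35%N, (true, true, true), [:: 0x6000088c2000040]);
   (36%N, (true, true, true), [:: 0x2002008006100040]);
   (37%N, (true, false, true), [:: 0x60000c00000]);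
   (38%N, (true, true, true), [:: 0x900000604000000; 0x900000640000000]);
   (39%N, (true, true, true), [:: 0x8126004400000]);
   (40%N, (true, true, true), [:: 0x180410200400000]);
   (41%N, (false, true, false), [:: 0x4218401]);
   (42%N, (true, true, true), [:: 0x80020242020000; 0x26042200000]);
   (43%N, (true, true, true), [:: 0x80420001820000]);
   (44%N, (true, true, false), [:: 0x40104000000]);
   (45%N, (true, true, true), [:: 0x100400200000180]);
   (46%N, (true, true, true), [:: 0x10002c042008000]);
   (47%N, (true, true, true), [:: 0x90000a024000080]);
   (48%N, (true, true, true), [:: 0x282004220000]);
   (49%N, (true, true, true), [:: 0x40400201800000]);
   (50%N, (true, true, true), [:: 0x1208006004000008]);
   (51%N, (true, true, true), [:: 0x280420200000080]);
   (52%N, (true, true, true), [:: 0x1000006002200800]);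
   (53%N, (false, false, true), [:: 0x60000c; 0x900006; 0x600009]);
   (53%N, (false, true, false), [:: 0x80010420]);
   (53%N, (false, true, true), [::
     0x60000090; 0x90000060; 0x60000060; 0x9060400; 0x200640; 0x6600000;
     0x6900000; 0x20920400; 0x3804042; 0x9804002; 0x43820240; 0x2040420;
     0x1104004; 0x60900; 0x10010440; 0x9900000; 0x60060000; 0x90090000;
     0x9004006; 0x8800220; 0x6804002; 0x90600; 0x1100440; 0x1804420;
     0x8802002; 0x80080220; 0x45824002; 0x20050420; 0x6340800; 0x1810420]);
   (53%N, (true, false, true), [::
     0x20000c0000900000; 0x60000600000; 0x20000c0000100004; 0x50000800002;
     0x60000900000; 0x90000000006; 0x90000500000; 0x60000000009;
     0x60000200004; 0x60000100004; 0x60000000006; 0x90000600000]);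
   (53%N, (true, true, false), [::
     0x42004200000; 0x20040000010400; 0x400040180000020; 0x42004010000;
     0x400842000200000; 0x400000100010400; 0x40104200000; 0x400002000000420;
     0x400000100000420; 0x42004000001; 0x1040004000001; 0x42004000020;
     0x400002000200400; 0x40104010000])]%num.

(* The inclusion-minimal sets of vectors that some continuation of the input
   sends to a vector violating the pseudoperiod condition. *)
Definition tm_unavoidable : seq N := [::
   0xcc00cc0000000000; 0x7700770000000000; 0xccc0ccc00000000;
   0xbff0bff00000000; 0x537053700000000; 0xcc00cc00cc00; 0xbb00ff00ff00;
   0xc0cccccccccc; 0xa0b3cc33ecb3; 0x550033007700; 0x505533337377;
   0x50fa55cc55fe; 0x77ee3bee55aa0aee; 0xc0c00cc0ccc; 0xb0b00ff0bff;
   0x3a3a3f0c3f3e; 0x3ffc73fc3c3c7370; 0x3330aff03030ace; 0x50500330537;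
   0xa5a5cd05eda5; 0xace05dd0a0a0555; 0x7755fbf55555faf0; 0xaff5fbfabffdfbfe;
   0x7350370750500707; 0xfcfebef0f0feaea; 0xe7e7fafef7effbfe;
   0xe0efbface0efffa; 0x5370033cd37cc33; 0xaff00ffeedfeecc;
   0x73733333ffd3ffc0; 0x73ff33ff73dc3330; 0x7377737700000000;
   0x55fe55fe00000000; 0x7700330077007700; 0xaee00ee7fee77ee;
   0x55005500ff00ee00; 0x7350330050770077; 0xaaeeaaccfffaff50;
   0xaaffaaffecf5eca0; 0x5550550050fe00ee; 0x3f3e3f3e00000000;
   0xccc00cc0ccc0ccc; 0x737033307ffc3ffc; 0xace00cc0b3b0333;
   0xf3f0f3c0fefecece; 0xc0c0c0cccccccc0; 0xe0e0c0c3b3a3330;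
   0xace0ace0dff0fff; 0x333a3b3fff0fff0; 0xaceaaeeffd0fff0; 0x537003305370537;
   0x55500550fcf0ace; 0xfaf0fa50f7f57755; 0x707030377557350;
   0xeaeacacaafef0fcf; 0x5050505eda5eca0; 0xace5adefdf0fdf0;
   0x5555555fbf0fbf0; 0x73507b5aeeaeeeae; 0x7070f0feaeeeaee;
   0x3300ff003300ee00; 0xcccccc00ccccc0; 0x33ecb30033eca0; 0xaadfccffeeff;
   0xaff33ff3bff3300; 0xaffaaffcedfee00; 0xf3d3ff33fff3; 0x737333ff73ff00cc;
   0x7373f3f3ff53ccc0; 0xfffc33eefcfc00ee; 0xffee33fcffaa3330;
   0x77737300557350; 0xeca0aaffececaaff; 0xee55dc00aa5550; 0x77fe33ee55fe00ee;
   0x5ffaaddcdffee00; 0x5ff55bb55ff5500; 0xfff7aa77f5f50055;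
   0x7ffa73fa5f5a5550; 0xaffffafbfffffff0; 0xee7faa00ee7fee;
   0x33303f0e30300e0e; 0x3ffe33fc3f3e3330; 0x3737f3c3ff37ccc0;
   0x37373c3f3f3f0c0c; 0xefffc3f3afaf0303; 0x7efe3afe5e5e0e0e;
   0xf7f7fafbffffeeee; 0x33307cfc33307ffc; 0xeca0f3f3ffa0f3f3;
   0x7350eaeeff50eeee; 0xfffe7afefffe7bfe; 0xffff5affffff7bfa;
   0xf5f7fafbfffffffa; 0xfbf0bf05f0f50555; 0xffff7b7bffff7afe;
   0xeaeec5cdabab0707; 0x7ffffaff7f5ffbfa; 0x7f5f7b5a5f5f5550;
   0x5fdf5ade5f5f0e0e; 0xf5f7faffffff7b5a; 0xafbffbfbffff5ade;
   0xeca0a5b7eca0edb7; 0x7f7ffafbff5ffffa; 0x5ffffafbdfdffefe;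
   0xf7f7fbfaf7fffbfe; 0xaffffafebffffbfe; 0x5550fafedd50fefe;
   0xfff75afbfff57ffa; 0xefff7a7befef7efe; 0x33003b0a00ff0aff;
   0xcc50dc33337373; 0xeea0eeffdcfffc; 0x3330b3b0ffceffee; 0x3bff33ff3bce00ee;
   0x77a0f7eeeeeeee; 0x7350735077377777; 0x7350f3f0eeceeeee;
   0xaaf7aaf7f7ff77ff; 0x7777337755370077; 0x7fee33ee5fce00ee;
   0xaaf7aa77ffff77ff; 0xfff03ff0d3f0333; 0x7ffc33fc7f5c3330;
   0xe3f3c3f3ffff3fff; 0xf3f3f3f3efa3eca0; 0xe3f3e3f3bfff3fff;
   0x7755f3f5ff55aaa0; 0xaffffafffffffbf0; 0xfcfabefcfcfe0e0;
   0xf7f7fbfbffffeaee; 0xace0acefffafff0; 0x73507350fefeeeee;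
   0xeeb333ffffff33ff; 0xecf333ffffff33ff; 0xacefbf0cecefff0;
   0xfffe7bfafffe7bfe; 0xffaaffccffeea0; 0x3333f3f3ff33ece0;
   0x7ffffbfb5fdffafe; 0x7f5ffbfaffdffbfe; 0x5fdffafeffdffbfe;
   0xafbffafbfffffefe]%num.

(** * Order flags and closure of the bounds under appending a letter *)

Definition letters : seq letter :=
  [seq (p, q) | p <- bool_pairs, q <- [:: false; true]].

Lemma mem_letters l : l \in letters.
Proof. by case: l => [[[] []] []]. Qed.

(* The default value is the full set, so that 53 gets no constraint. *)
Definition upper_mask (q : nat) : N := nth (N.ones 64) tm_upper q.

Definition all_differ_mask : N := mask_of [seq v <- vecs | all_differ v].

(* Update of the truth value s of m < n, resp. validity of m <= n, when the digits
   x and y are appended to m <= n. *)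
Definition lt_next (s x y : bool) : bool := s || (~~ x && y).

Definition le_next (s x y : bool) : bool := s || (x ==> y).

(** The test 0 < a compares a with a number all of whose digits are 0, hence the digit [false]. *)
Definition flags_next (f l : bool * bool * bool) : bool * bool * bool :=
  (lt_next f.1.1 false l.1.1, lt_next f.1.2 l.1.1 l.1.2, lt_next f.2 l.1.2 l.2).

Definition flags_ok (f l : bool * bool * bool) : bool :=
  le_next f.1.2 l.1.1 l.1.2 && le_next f.2 l.1.2 l.2.

Definition flags_strict (f : bool * bool * bool) : bool :=
  [&& f.1.1, f.1.2 & f.2].

Definition has_flags (f : bool * bool * bool) (a b c : nat) : Prop :=
  [/\ f = (0 < a, a < b, b < c), a <= b & b <= c].

(** A strict order between prefixes survives any further digits; between equal prefixes the new
    digits decide. *)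
Lemma has_flags_next f (l : letter) a b c : has_flags f a b c ->
  if flags_ok f l
  then has_flags (flags_next f l) (2 * a + l.1.1) (2 * b + l.1.2) (2 * c + l.2)
  else 2 * b + l.1.2 < 2 * a + l.1.1 \/ 2 * c + l.2 < 2 * b + l.1.2.
Proof.
case: l => [[x y] z] [-> le_ab le_bc].
rewrite /flags_ok /flags_next /le_next /lt_next /=.
have Hab: (a < b) || (x ==> y) = (2 * a + x <= 2 * b + y).
  by case: x; case: y; rewrite /= ?orbT ?orbF; lia.
have Hbc: (b < c) || (y ==> z) = (2 * b + y <= 2 * c + z).
  by case: y {Hab}; case: z; rewrite /= ?orbT ?orbF; lia.
rewrite Hab Hbc; case: ifP => [/andP[leab lebc]|/negbT]; last first.
  by rewrite negb_and -!ltnNge => /orP.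
split=> //; congr (_, _, _).
- by case: x {Hab leab}; rewrite /= ?orbT ?orbF; lia.
- by case: x {Hab leab}; case: y {Hbc lebc}; rewrite /= ?orbT ?orbF; lia.
- by case: y {Hab leab Hbc lebc}; case: z; rewrite /= ?orbT ?orbF; lia.
Qed.

(** Meeting the whole family persists under every letter by [tm_unavoidable_closed], and
    [all_differ_mask] is in the family, so neither the triple nor any extension is a
    pseudoperiod. *)
Definition doomed (m : N) : bool := all (meets m) tm_unavoidable.

(** A dead run need not be doomed at once: the entries of [tm_lower] for 53 track lower bounds while
    some flag is still false. None has all three flags true, so from then on 53 requires
    [doomed]. *)
Definition lower_step_ok (q : nat) (f : bool * bool * bool) (m : N) (l : letter) :
    bool :=
  let q' := tm_delta q l in
  if flags_ok f l then
    let f' := flags_next f l in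
    let m' := image_mask l m in
    if has (fun e => if e.1.2 == f' then
                       if e.1.1 == q' then has (sub_mask^~ m') e.2 else false
                     else false) tm_lower
    then true else if q' == 53 then doomed m' else false
  else q' == 53.

Lemma tm_lower_closed :
  all (fun e => all (fun m => all (lower_step_ok e.1.1 e.1.2 m) letters) e.2)
      tm_lower.
Proof. by vm_compute. Qed.

Lemma tm_upper_closed :
  all (fun q => all (fun l => sub_mask (image_mask l (upper_mask q))
                                       (upper_mask (tm_delta q l))) letters)
      (iota 0 54).
Proof. by vm_compute. Qed.

(** A member of the family is met after a letter if its preimage was met before, which is certain
    when that preimage contains a member of the family. *)
Lemma tm_unavoidable_closed :
  all (fun m => all (fun l => let m' := preimage_mask l m in
                              has (sub_mask^~ m') tm_unavoidable) letters)
      tm_unavoidable.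
Proof. by vm_compute. Qed.

(** Upper bounds certify acceptance, as a final state leaves room for no violating vector; lower
    bounds certify rejection, as elsewhere they supply one for every strictly increasing triple. *)
Lemma tm_finals_correct :
  all (fun e => if e.1.1 \in tm_finals
                then flags_strict e.1.2
                     && N.eqb (N.land (upper_mask e.1.1) all_differ_mask) 0
                else flags_strict e.1.2 ==> all (meets^~ all_differ_mask) e.2)
      tm_lower.
Proof. by vm_compute. Qed.

(** * The invariant along a run *)

(** The first two cases are permanent reasons to reject. In the third, S(a,b,c) lies between two
    masks; this case includes dead runs, whose upper mask is trivial. *)
Variant state_spec (q a b c : nat) : Prop :=
  | SpecUnordered of q = 53 & b < a \/ c < b
  | SpecDoomed of q = 53 &
      forall m, m \in tm_unavoidable -> exists2 v, mem_mask m v & occurs a b c v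
  | SpecBounded f ms m of (q, f, ms) \in tm_lower & m \in ms & has_flags f a b c &
      (forall v, mem_mask m v -> occurs a b c v) &
      (forall v, occurs a b c v -> mem_mask (upper_mask q) v).

Lemma state_spec0 : state_spec 0 0 0 0.
Proof.
(* For a = b = c = 0 a vector is three copies of (0, t[i] + t[i+1]): code 0 at i = 1, and code 21,
   binary 010101, at i = 0. *)
have ms0 : (0, (false, false, false), [:: mask_of [:: decode 0; decode 21]])
             \in tm_lower by [].
apply: SpecBounded ms0 (mem_head _ _) _ _ _ => // v.
  by rewrite mem_mask_of !inE => /orP[] /eqP ->; [exists 1 | exists 0].
case=> i <-; rewrite /diff_vec /diffs !addn0.
by case: (thue_morse i); case: (thue_morse i.+1).
Qed.

Lemma state_spec_next q a b c (l : letter) : q <= 53 -> state_spec q a b c ->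
  state_spec (tm_delta q l) (2 * a + l.1.1) (2 * b + l.1.2) (2 * c + l.2).
Proof.
have delta53 : tm_delta 53 l = 53.
  by rewrite /tm_delta (nth_default [::]) // nth_nil.
move=> le53 [-> unord|-> doom|f ms m q_in m_in fl low upp].
- apply: SpecUnordered; rewrite ?delta53 //.
  (* A strict inequality in the wrong direction also survives doubling, as digits are at most 1. *)
  by case: l {delta53} => [[[] []] []] /=; lia.
- apply: SpecDoomed; rewrite ?delta53 // => m m_in.
  have /allP/(_ m m_in)/allP/(_ l (mem_letters l))/hasP[m' m'_in sub] :=
    tm_unavoidable_closed.
  have [v m'v occ] := doom m' m'_in.
  have [e mv] := mem_preimage_mask (sub_maskP sub m'v).
  by exists (next l e v) => //; exact: occurs_next.
have := has_flags_next l fl.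
have /allP/(_ _ q_in)/allP/(_ m m_in)/allP/(_ l (mem_letters l)) := tm_lower_closed.
have low' v : mem_mask (image_mask l m) v ->
    occurs (2 * a + l.1.1) (2 * b + l.1.2) (2 * c + l.2) v.
  by case/mem_image_mask=> u /low occ [e ->]; exact: occurs_next.
rewrite /lower_step_ok; case: (flags_ok f l); lazy beta iota zeta; last first.
  by move=> /eqP-> unord; exact: SpecUnordered.
(* Either a matching entry takes over the lower bound and the image of the upper bound, or the image
   of the lower bound is doomed. *)
case: ifP => [/hasP[[[q' f'] ms'] e_in]|_].
  cbn [fst snd]; case: eqP => // f'E; case: eqP => // q'E.
  move=> /hasP[m' m'_in sub] _ fl'.
  subst f' q'.
  apply: (SpecBounded e_in m'_in fl') => [v m'v|v /occurs_nextP[u occ [e ->]]].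
    exact/low'/(sub_maskP sub).
  have q_in54 : q \in iota 0 54 by rewrite mem_iota.
  have /allP/(_ q q_in54)/allP/(_ l (mem_letters l)) sub' := tm_upper_closed.
  by apply: (sub_maskP sub'); apply/mem_image_mask; exists u; [exact: upp|exists e].
case: eqP => // -> /allP doom _; apply: SpecDoomed => // m' /doom/meetsP[v mv m'v].
by exists v => //; exact: low'.
Qed.

(** * From the invariant to acceptance *)

Lemma base2_value_rcons s d : base2_value (rcons s d) = 2 * base2_value s + d.
Proof. by rewrite /base2_value foldl_rcons. Qed.

Lemma state_spec_run w :
  state_spec (state_index (dfa_run tm_dfa w))
    (base2_value [seq x.1.1 | x <- w]) (base2_value [seq x.1.2 | x <- w])
    (base2_value [seq x.2 | x <- w]).
Proof.
(* The most significant digit comes first, so a letter appended on the right doubles the values and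
   adds its digits. *)
elim/last_ind: w => [|w l IH]; first exact: state_spec0.
rewrite !map_rcons !base2_value_rcons /dfa_run foldl_rcons -/(dfa_run _ _).
rewrite state_index_trans; apply: state_spec_next IH.
by case: (dfa_run _ _) => [q|] //=; exact/ltnW/ltn_ord.
Qed.

Lemma dfa_accepts_index w :
  dfa_accepts tm_dfa w = (state_index (dfa_run tm_dfa w) \in tm_finals).
Proof. by rewrite /dfa_accepts; case: (dfa_run _ _) => [q|] //=; rewrite inE. Qed.

Lemma mem_all_differ_mask v : mem_mask all_differ_mask v = all_differ v.
Proof. by rewrite mem_mask_of mem_filter mem_vecs andbT. Qed.

Lemma state_spec_final q a b c : state_spec q a b c ->
  q \in tm_finals <-> in_T a b c.
Proof.
have differ v : occurs a b c v -> all_differ v -> ~ in_T a b c.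
  by move=> occ dv [_ _ _ /pseudoperiod3P/(_ v occ)]; rewrite dv.
case=> [-> unord|-> doom|f ms m q_in m_in [fE le_ab le_bc] low upp].
- by split=> // -[_ lt_ab lt_bc _]; lia.
(* The set of violating vectors belongs to the unavoidable family, which is checked by
   computation. *)
- split=> // inT; have [|v] := doom all_differ_mask; first by [].
  by rewrite mem_all_differ_mask => dv occ; case: (differ v).
have /allP/(_ _ q_in) /= := tm_finals_correct.
have strictE : flags_strict f = [&& 0 < a, a < b & b < c] by rewrite fE.
rewrite strictE; case: ifP => [_ /andP[/and3P[a0 ab bc] /N.eqb_spec disj]|_ hit].
  split=> // _; split=> //; apply/pseudoperiod3P => v /upp mv.
  (* A violating vector in S(a,b,c) would lie in both masks, whose intersection is empty. *)
  apply/negP; rewrite -mem_all_differ_mask => dv.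
  have := N.land_spec (upper_mask q) all_differ_mask (code v).
  by rewrite disj [X in _ = X && _]mv [X in _ = X]dv; case: (code v).
split=> // inT; have [a0 ab bc _] := inT.
move: hit; rewrite a0 ab bc /= => /allP/(_ m m_in)/meetsP[v /low occ].
by rewrite mem_all_differ_mask => dv; case: (differ v).
Qed.

Theorem theorem15 :
  exists A : dfa (bool * bool * bool),
    #|dfa_state A| = 53 /\
    forall (a b c : nat) (w : seq (bool * bool * bool)),
      represents w a b c -> (dfa_accepts A w <-> in_T a b c).
Proof.
exists tm_dfa; split=> [|a b c w [<- <- <-]]; first exact: card_ord.
by rewrite dfa_accepts_index; apply: state_spec_final; exact: state_spec_run.
Qed.
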